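(* Cut elimination is well-defined: if $f$ is a proof net on a cut sequent consisting of $\Gamma$ together with a cut pair on a formula $A$, then the result $f'$ of eliminating this cut is again a proof net (on the resulting cut sequent).
   Context: Formulas (MLL) are built from literals (propositional variables $P,Q,\dots$ and their duals $P^\bot,Q^\bot,\dots$) and units $1,\bot$ by the binary connectives $\otimes$ (tensor) and $\wp$ (par, the multiplicative disjunction of linear logic). An atom is a literal or a unit. Negation $(-)^\bot$ extends to all formulas by $P^{\bot\bot}=P$, $\bot^\bot=1$, $1^\bot=\bot$, $(A\otimes B)^\bot=A^\bot\wp B^\bot$, $(A\wp B)^\bot=A^\bot\otimes B^\bot$. A formula is identified with its parse tree (leaves labelled by atoms, internal vertices by connectives). A leaf (or atom) is positive if labelled by a propositional variable or $1$, and negative if labelled by a dual $P^\bot$ or by $\bot$. A sequent is a non-empty disjoint union of formulas (a labelled forest). A cut pair on $A$ is the disjoint union of $A$ and $A^\bot$ together with an undirected edge (a cut) between their roots. A cut sequent is a disjoint union of a sequent and zero or more cut pairs. A switching of a cut sequent is any subgraph obtained by deleting, for each $\wp$ vertex, one of its two argument edges. A leaf function on a cut sequent is a function from its negative leaves to its positive leaves. A proof net on a cut sequent $\Gamma$ is a leaf function $f$ on $\Gamma$ such that: (Matching) for every propositional variable $P$, $f$ restricts to a bijection between the $P^\bot$-labelled leaves and the $P$-labelled leaves of $\Gamma$; (Switching) for every switching $\Gamma'$ of $\Gamma$, the undirected graph obtained by adding the edges $\{l,f(l)\}$ of $f$ to $\Gamma'$ is a tree (acyclic and connected; parallel edges count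 as a cycle). Eliminating a cut. Let $f$ be a proof net on the cut sequent consisting of $\Gamma$ and a cut pair on $A$. - Atom: if $A$ is an atom, say (without loss of generality) positive, delete the cut pair $A,A^\bot$, and reset every edge of $f$ targeting the leaf $A$ to target $f(A^\bot)$ instead. - Compound: if $A$ is compound, say (without loss of generality) $A=B\otimes C$ and $A^\bot=B^\bot\wp C^\bot$, replace the cut pair on $A$ by two cut pairs, one on $B$ (joining the roots of $B$ and $B^\bot$) and one on $C$ (joining the roots of $C$ and $C^\bot$); the leaves and the function $f$ are unchanged. *)

(* Defs.v *)
From HB Require Import structures.
From mathcomp Require Import all_boot.

Set Implicit Arguments.
Unset Strict Implicit.
Unset Printing Implicit Defensive.

Inductive atom (V : Type) : Type :=
| Var of V
| Dual of V
| One
| Bot.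

Arguments One {V}.
Arguments Bot {V}.

Inductive formula (V : Type) : Type :=
| Atom of atom V
| Tensor of formula V & formula V
| Par of formula V & formula V.

Definition neg_atom V (a : atom V) : atom V :=
  match a with
  | Var P => Dual P
  | Dual P => Var P
  | One => Bot
  | Bot => One
  end.

Fixpoint neg V (A : formula V) : formula V :=
  match A with
  | Atom a => Atom (neg_atom a)
  | Tensor B C => Par (neg B) (neg C)
  | Par B C => Tensor (neg B) (neg C)
  end.

Definition pos_atom V (a : atom V) : bool :=
  match a with Var _ | One => true | Dual _ | Bot => false end.

(* In a compound formula, [None] is the root and [Some (inl u)], [Some (inr u)]
   are the vertices of the left and right arguments. *)
Fixpoint vertex V (A : formula V) : finType :=
  match A with
  | Atom _ => unit
  | Tensor B C | Par B C => option (vertex B + vertex C)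
  end.

Definition root V (A : formula V) : vertex A :=
  match A with
  | Atom _ => tt
  | Tensor _ _ | Par _ _ => None
  end.

Inductive vlabel (V : Type) : Type :=
| LAtom of atom V
| LTensor
| LPar.

Arguments LTensor {V}.
Arguments LPar {V}.

Fixpoint label V (A : formula V) : vertex A -> vlabel V :=
  match A with
  | Atom a => fun=> LAtom a
  | Tensor B C => fun v =>
      match v with
      | None => LTensor
      | Some (inl u) => label u
      | Some (inr u) => label u
      end
  | Par B C => fun v =>
      match v with
      | None => LPar
      | Some (inl u) => label u
      | Some (inr u) => label u
      end
  end.

(* [inl b] is the edge from the root to its left ([b = false]) or right
   ([b = true]) argument; [inr] collects the edges inside the arguments. *)
Fixpoint arg_edge V (A : formula V) : finType :=
  match A with
  | Atom _ => void
  | Tensor B C | Par B C => bool + (arg_edge B + arg_edge C)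
  end%type.

Fixpoint edge_parent V (A : formula V) : arg_edge A -> vertex A :=
  match A with
  | Atom _ => of_void _
  | Tensor B C | Par B C => fun e =>
      match e with
      | inl _ => None
      | inr (inl e1) => Some (inl (edge_parent e1))
      | inr (inr e2) => Some (inr (edge_parent e2))
      end
  end.

Fixpoint edge_child V (A : formula V) : arg_edge A -> vertex A :=
  match A with
  | Atom _ => of_void _
  | Tensor B C | Par B C => fun e =>
      match e with
      | inl false => Some (inl (root B))
      | inl true => Some (inr (root C))
      | inr (inl e1) => Some (inl (edge_child e1))
      | inr (inr e2) => Some (inr (edge_child e2))
      end
  end.

Fixpoint edge_side V (A : formula V) : arg_edge A -> bool :=
  match A with
  | Atom _ => of_void _
  | Tensor B C | Par B C => fun e =>
      match e with
      | inl b => b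
      | inr (inl e1) => edge_side e1
      | inr (inr e2) => edge_side e2
      end
  end.

Record multigraph : Type := MultiGraph {
  mvertex : finType;
  medge : finType;
  mends : medge -> mvertex * mvertex
}.

Definition joins (G : multigraph) (e : medge G) (x y : mvertex G) : bool :=
  (mends e == (x, y)) || (mends e == (y, x)).

Definition adjacent (G : multigraph) : rel (mvertex G) :=
  [rel x y | [exists e, joins e x y]].

Fixpoint walk (G : multigraph) (x : mvertex G)
    (p : seq (medge G * mvertex G)) : bool :=
  if p is (e, y) :: p' then joins e x y && walk y p' else true.

(* Edges are required to be distinct as edges, not as pairs of endpoints, so
   that two parallel edges form a cycle of length 2. *)
Definition is_cycle (G : multigraph) (x : mvertex G)
    (p : seq (medge G * mvertex G)) : bool :=
  [&& p != [::], walk x p, last x (unzip2 p) == x,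
      uniq (unzip1 p) & uniq (unzip2 p)].

Definition acyclic (G : multigraph) : Prop :=
  forall (x : mvertex G) p, ~~ is_cycle x p.

Definition connected (G : multigraph) : Prop :=
  forall x y : mvertex G, connect (@adjacent G) x y.

Definition is_tree (G : multigraph) : Prop := acyclic G /\ connected G.

(* Disjoint unions are families indexed by finite types. The cut indexed by [k]
   is the cut pair on [cut_formula k]. *)
Record cut_sequent (V : Type) : Type := CutSequent {
  concl : finType;
  concl_formula : concl -> formula V;
  cut : finType;
  cut_formula : cut -> formula V;
  concl_gt0 : 0 < #|concl|
}.

Definition tree V (G : cut_sequent V) : finType := (concl G + cut G * bool)%type.

Definition tree_formula V (G : cut_sequent V) (t : tree G) : formula V :=
  match t with
  | inl i => concl_formula i
  | inr (k, false) => cut_formula k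
  | inr (k, true) => neg (cut_formula k)
  end.

Definition cs_vertex V (G : cut_sequent V) : finType :=
  {t : tree G & vertex (tree_formula t)}.

Definition in_tree V (G : cut_sequent V) (t : tree G)
    (v : vertex (tree_formula t)) : cs_vertex G :=
  Tagged (fun t : tree G => vertex (tree_formula t)) v.

Definition cs_label V (G : cut_sequent V) (v : cs_vertex G) : vlabel V :=
  label (tagged v).

Definition cs_arg_edge V (G : cut_sequent V) : finType :=
  {t : tree G & arg_edge (tree_formula t)}.

Definition cs_edge V (G : cut_sequent V) : finType :=
  (cs_arg_edge G + cut G)%type.

Definition cs_ends V (G : cut_sequent V) (e : cs_edge G) :
    cs_vertex G * cs_vertex G :=
  match e with
  | inl a => (in_tree (edge_parent (tagged a)), in_tree (edge_child (tagged a)))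
  | inr k => (in_tree (root (tree_formula (inr (k, false) : tree G))),
              in_tree (root (tree_formula (inr (k, true) : tree G))))
  end.

(* A switching is given by the side [s v] of the argument edge that is kept at
   each par vertex [v]; the values of [s] at other vertices are irrelevant. *)
Definition kept V (G : cut_sequent V) (s : cs_vertex G -> bool)
    (e : cs_edge G) : bool :=
  match e with
  | inl a =>
      let v := in_tree (edge_parent (tagged a)) in
      if cs_label v is LPar then edge_side (tagged a) == s v else true
  | inr _ => true
  end.

Definition is_neg_leaf V (G : cut_sequent V) (v : cs_vertex G) : bool :=
  if cs_label v is LAtom a then ~~ pos_atom a else false.

Definition is_pos_leaf V (G : cut_sequent V) (v : cs_vertex G) : bool :=
  if cs_label v is LAtom a then pos_atom a else false.

Definition neg_leaf V (G : cut_sequent V) : finType :=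
  {v : cs_vertex G | is_neg_leaf v}.

Definition pos_leaf V (G : cut_sequent V) : finType :=
  {v : cs_vertex G | is_pos_leaf v}.

Definition leaf_function V (G : cut_sequent V) : Type :=
  {ffun neg_leaf G -> pos_leaf G}.

Definition var_leaves (V : eqType) (G : cut_sequent V) (P : V) :
    {set pos_leaf G} :=
  [set l | if cs_label (val l) is LAtom (Var Q) then Q == P else false].

Definition dual_leaves (V : eqType) (G : cut_sequent V) (P : V) :
    {set neg_leaf G} :=
  [set l | if cs_label (val l) is LAtom (Dual Q) then Q == P else false].

Definition matching (V : eqType) (G : cut_sequent V) (f : leaf_function G) :
    Prop :=
  forall P : V, {in dual_leaves G P &, injective f} /\
                f @: dual_leaves G P = var_leaves G P.

Definition switching_graph V (G : cut_sequent V) (f : leaf_function G)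
    (s : cs_vertex G -> bool) : multigraph :=
  @MultiGraph (cs_vertex G) ({e : cs_edge G | kept s e} + neg_leaf G)%type
    (fun e => match e with
              | inl e0 => cs_ends (val e0)
              | inr l => (val l, val (f l))
              end).

Definition proof_net (V : eqType) (G : cut_sequent V) (f : leaf_function G) :
    Prop :=
  matching f /\
  forall s : cs_vertex G -> bool, is_tree (switching_graph f s).

Definition add_cut V (G : cut_sequent V) (A : formula V) : cut_sequent V :=
  @CutSequent V (concl G) (@concl_formula V G) (option (cut G))
    (fun k => if k is Some k0 then cut_formula k0 else A) (concl_gt0 G).

(* For a compound [A] both orientations give the same (unordered) cut pairs,
   because negation is involutive. *)
Definition elim_sequent V (G : cut_sequent V) (A : formula V) : cut_sequent V :=
  match A with
  | Atom _ => G
  | Tensor B C | Par B C => add_cut (add_cut G B) C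
  end.

Definition cut_vertex V (G : cut_sequent V) (A : formula V) (b : bool)
    (v : vertex (tree_formula (inr (None, b) : tree (add_cut G A)))) :
    cs_vertex (add_cut G A) := in_tree v.

Definition old_vertex V (G : cut_sequent V) (A : formula V) (v : cs_vertex G) :
    cs_vertex (add_cut G A) :=
  match v with
  | existT (inl i) u => @in_tree V (add_cut G A) (inl i) u
  | existT (inr (k, false)) u => @in_tree V (add_cut G A) (inr (Some k, false)) u
  | existT (inr (k, true)) u => @in_tree V (add_cut G A) (inr (Some k, true)) u
  end.

Arguments old_vertex {V G} A v.

(* The identification of vertices after the elimination with vertices before
   it; in the compound case its image omits the roots of [A] and [neg A]. *)
Definition elim_vertex V (G : cut_sequent V) (A : formula V) :
    cs_vertex (elim_sequent G A) -> cs_vertex (add_cut G A) :=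
  match A return cs_vertex (elim_sequent G A) -> cs_vertex (add_cut G A) with
  | Atom a => old_vertex (Atom a)
  | Tensor B C => fun v =>
      match v with
      | existT (inl i) u =>
          @in_tree V (add_cut G (Tensor B C)) (inl i) u
      | existT (inr (Some (Some k), false)) u =>
          @in_tree V (add_cut G (Tensor B C)) (inr (Some k, false)) u
      | existT (inr (Some (Some k), true)) u =>
          @in_tree V (add_cut G (Tensor B C)) (inr (Some k, true)) u
      | existT (inr (Some None, false)) u =>
          @cut_vertex V G (Tensor B C) false (Some (inl u))
      | existT (inr (Some None, true)) u =>
          @cut_vertex V G (Tensor B C) true (Some (inl u))
      | existT (inr (None, false)) u =>
          @cut_vertex V G (Tensor B C) false (Some (inr u))
      | existT (inr (None, true)) u =>
          @cut_vertex V G (Tensor B C) true (Some (inr u))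
      end
  | Par B C => fun v =>
      match v with
      | existT (inl i) u =>
          @in_tree V (add_cut G (Par B C)) (inl i) u
      | existT (inr (Some (Some k), false)) u =>
          @in_tree V (add_cut G (Par B C)) (inr (Some k, false)) u
      | existT (inr (Some (Some k), true)) u =>
          @in_tree V (add_cut G (Par B C)) (inr (Some k, true)) u
      | existT (inr (Some None, false)) u =>
          @cut_vertex V G (Par B C) false (Some (inl u))
      | existT (inr (Some None, true)) u =>
          @cut_vertex V G (Par B C) true (Some (inl u))
      | existT (inr (None, false)) u =>
          @cut_vertex V G (Par B C) false (Some (inr u))
      | existT (inr (None, true)) u =>
          @cut_vertex V G (Par B C) true (Some (inr u))
      end
  end.

Lemma elim_vertex_label V (G : cut_sequent V) (A : formula V)
    (v : cs_vertex (elim_sequent G A)) :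
  cs_label (elim_vertex v) = cs_label v.
Proof.
case: A v => [a|B C|B C] /=.
- by case=> [[i|[k []]] u].
- by case=> [[i|[[[k|]|] []]] u].
- by case=> [[i|[[[k|]|] []]] u].
Qed.

Lemma elim_vertex_neg V (G : cut_sequent V) (A : formula V)
    (l : neg_leaf (elim_sequent G A)) : is_neg_leaf (elim_vertex (val l)).
Proof. by rewrite /is_neg_leaf elim_vertex_label; apply: (valP l). Qed.

Definition elim_neg_leaf V (G : cut_sequent V) (A : formula V)
    (l : neg_leaf (elim_sequent G A)) : neg_leaf (add_cut G A) :=
  Sub (elim_vertex (val l)) (elim_vertex_neg l).

(* The root of [A] if [b = false], that of the negation of [A] if [b = true].
   Thus for an atom [a] the positive leaf of the cut pair is
   [cut_root G (Atom a) (~~ pos_atom a)], the negative one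
   [cut_root G (Atom a) (pos_atom a)]. *)
Definition cut_root V (G : cut_sequent V) (A : formula V) (b : bool) :
    cs_vertex (add_cut G A) := @cut_vertex V G A b (root _).

Lemma cut_root_neg V (G : cut_sequent V) (a : atom V) :
  is_neg_leaf (cut_root G (Atom a) (pos_atom a)).
Proof. by case: a. Qed.

Definition cut_neg_leaf V (G : cut_sequent V) (a : atom V) :
    neg_leaf (add_cut G (Atom a)) :=
  Sub (cut_root G (Atom a) (pos_atom a)) (cut_root_neg G a).

Definition reset_target V (G : cut_sequent V) (A : formula V) :
    leaf_function (add_cut G A) -> pos_leaf (add_cut G A) ->
    pos_leaf (add_cut G A) :=
  match A with
  | Atom a => fun f m =>
      if val m == cut_root G (Atom a) (~~ pos_atom a)
      then f (cut_neg_leaf G a) else m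
  | Tensor _ _ | Par _ _ => fun _ m => m
  end.

(* [f'] is the result of eliminating from [f] the cut pair on [A]. This is a
   relation because, for an atom [A], a leaf function [f] that links the two
   leaves of the cut pair leaves other edges into them without a new target. *)
Definition cut_elim V (G : cut_sequent V) (A : formula V)
    (f : leaf_function (add_cut G A)) (f' : leaf_function (elim_sequent G A)) :
    Prop :=
  forall l : neg_leaf (elim_sequent G A),
    elim_vertex (val (f' l)) = val (reset_target f (f (elim_neg_leaf l))).

(* Main.v *)
Require Import Defs.
From mathcomp Require Import all_boot.
From mathcomp Require Import zify.

(** A nonempty connected multigraph is a tree exactly when it has one more vertex
    than it has edges. Eliminating a cut removes two vertices and two edges from
    every switching graph, so it suffices to show that connectedness is preserved.
    For an atomic cut, the new graph is the old one with the cut edge and the edge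
    from the negative leaf contracted. For a compound cut, remove the two roots [r]
    (tensor, arguments [b], [c]) and [r'] (par, arguments [b'], [c']) and let [H]
    be the rest. Contracting [r] and [r'], both [H + bc + bb'] and [H + bc + bc']
    are connected. By counting, [b'] is connected in [H] neither to [b] nor to [c],
    hence, by the second graph, it is connected to [c']. Thus [H + bb' + cc'] is
    connected. *)

Set Implicit Arguments.
Unset Strict Implicit.
Unset Printing Implicit Defensive.

(** * Connectedness and edge counts of multigraphs *)

(* Union-find: [color s u = color s v] iff [u] and [v] are connected by the edges in
   [s], and the image of [color s] has one element per component. *)
Fixpoint color (T : eqType) (s : seq (T * T)) (v : T) : T :=
  if s is (x, y) :: s' then
    if color s' v == color s' x then color s' y else color s' v
  else v.

Lemma color_edge (T : eqType) (s : seq (T * T)) x y :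
  (x, y) \in s -> color s x = color s y.
Proof.
elim: s => [//|[a b] s IHs]; rewrite inE => /orP[/eqP[-> ->]|/IHs] /=.
  by rewrite eqxx; case: ifP.
by move=> ->.
Qed.

Lemma color_connect (T : finType) (e : rel T) (s : seq (T * T)) u v :
  symmetric e -> {in s, forall p, e p.1 p.2} ->
  color s u = color s v -> connect e u v.
Proof.
move=> e_sym; elim: s u v => [|[x y] s IHs] u v /= sE; first by move=> ->.
have sE' : {in s, forall p, e p.1 p.2} by move=> p ps; apply: sE; rewrite inE ps orbT.
have xy : connect e x y by apply: connect1; apply: (sE (x, y)); rewrite mem_head.
have yx : connect e y x by rewrite (sym_connect_sym e_sym).
have con := IHs _ _ sE'.
case: eqP => [/con ux|_]; case: eqP => [/con vx|_].
- by move=> _; apply: connect_trans ux _; rewrite (sym_connect_sym e_sym).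
- by move=> /con yv; apply: connect_trans ux (connect_trans xy yv).
- move=> /con uy; apply: connect_trans uy (connect_trans yx _).
  by rewrite (sym_connect_sym e_sym).
- exact: con.
Qed.

(** The added edge merges two classes, and the colour of [x] disappears unless both ends had the
    same colour already. *)
Lemma codom_color_cons (T : finType) (s : seq (T * T)) x y :
  [set color ((x, y) :: s) v | v : T] =
  if color s x == color s y then [set color s v | v : T]
  else [set color s v | v : T] :\ color s x.
Proof.
apply/setP=> z; apply/imsetP/idP => [[v _ ->]|] /=.
  case: (altP (color s x =P color s y)) => [<-|xy].
    by case: eqP => _; apply: imset_f.
  case: (altP (color s v =P color s x)) => [_|vx];
    by rewrite !inE ?vx 1?eq_sym ?xy imset_f.
case: (altP (color s x =P color s y)) => [xy /imsetP[v _ ->]|xy].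
  by exists v => //; rewrite -xy; case: eqP.
rewrite inE => /andP[+ /imsetP[v _ zE]]; rewrite zE inE => /negPf vx.
by exists v => //; rewrite vx.
Qed.

(** Each edge joins two different components of the edges after it in the list, so it lowers the
    number of components by exactly one. *)
Fixpoint forest (T : eqType) (s : seq (T * T)) : bool :=
  if s is (x, y) :: s' then (color s' x != color s' y) && forest s' else true.

Lemma card_color_le (T : finType) (s : seq (T * T)) :
  #|T| <= #|[set color s v | v : T]| + size s.
Proof.
elim: s => [|[x y] s IHs]; first by rewrite addn0 card_imset.
rewrite codom_color_cons /=; case: ifP => _; first by rewrite addnS leqW.
by move: IHs; rewrite (cardsD1 (color s x) [set _ | _ in _]) imset_f // addSn addnS.
Qed.

Lemma card_color_forest (T : finType) (s : seq (T * T)) :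
  forest s -> #|T| = #|[set color s v | v : T]| + size s.
Proof.
elim: s => [|[x y] s IHs]; first by rewrite addn0 card_imset.
move=> /andP[xy /IHs]; rewrite codom_color_cons (negPf xy) /=.
by rewrite (cardsD1 (color s x) [set _ | _ in _]) imset_f // addSn addnS.
Qed.

Lemma card_const_color (T : finType) (s : seq (T * T)) :
  (forall u v, color s u = color s v) -> #|T| <= (size s).+1.
Proof.
move=> sC; case: (pickP (@predT T)) => [x _|T0]; last by rewrite eq_card0.
apply: leq_trans (card_color_le s) _; rewrite -add1n leq_add2r.
rewrite -(cards1 (color s x)); apply/subset_leq_card/subsetP=> _ /imsetP[v _ ->].
by rewrite inE (sC v x).
Qed.

Lemma joins_sym (G : multigraph) (e : medge G) x y : joins e x y = joins e y x.
Proof. by rewrite /joins orbC. Qed.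

Lemma adjacent_sym (G : multigraph) : symmetric (@adjacent G).
Proof. by move=> x y; apply: eq_existsb => e; rewrite joins_sym. Qed.

Lemma connectC (G : multigraph) (x y : mvertex G) :
  connect (@adjacent G) x y = connect (@adjacent G) y x.
Proof. exact: sym_connect_sym (@adjacent_sym G) x y. Qed.

Lemma joins_connect (G : multigraph) (e : medge G) x y :
  joins e x y -> connect (@adjacent G) x y.
Proof. by move=> exy; apply/connect1/existsP; exists e. Qed.

Lemma mends_connect (G : multigraph) (e : medge G) :
  connect (@adjacent G) (mends e).1 (mends e).2.
Proof. by apply: (@joins_connect _ e); rewrite /joins -surjective_pairing eqxx. Qed.

Lemma connect_invariant (T : finType) (e : rel T) (S : T -> Prop) x y :
  (forall u v, e u v -> S u -> S v) -> connect e x y -> S x -> S y.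
Proof.
move=> eS /connectP[p + ->]; elim: p x => [//|z p IHp] x /= /andP[xz zp] Sx.
by apply: IHp zp _; apply: eS xz Sx.
Qed.

(** The list [s] may omit edges whose ends it connects anyway, which lets [connected_card_tree]
    leave one edge out. *)
Lemma connected_color (G : multigraph) (s : seq (mvertex G * mvertex G)) :
  connected G ->
  (forall e : medge G, color s (mends e).1 = color s (mends e).2) ->
  #|mvertex G| <= (size s).+1.
Proof.
move=> Gc sE; apply: card_const_color => u v.
apply: (connect_invariant (S := fun w => color s u = color s w) _ (Gc u v)) => // x y.
by case/existsP=> e /orP[] /eqP ee ->; have := sE e; rewrite ee.
Qed.

Lemma connected_card (G : multigraph) :
  connected G -> #|mvertex G| <= #|medge G|.+1.
Proof.
move=> Gc; rewrite [#|medge G|]cardE -(size_map (@mends G)).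
apply: connected_color => // e.
by apply: color_edge; rewrite -surjective_pairing map_f ?mem_enum.
Qed.

Lemma walk_color (G : multigraph) (s : seq (mvertex G * mvertex G)) x p :
  walk x p -> {in unzip1 p, forall e, mends e \in s} ->
  color s x = color s (last x (unzip2 p)).
Proof.
elim: p x => [//|[e y] p IHp] x /= /andP[exy yp] ps.
rewrite -IHp // => [|e' e'p]; last by apply: ps; rewrite inE e'p orbT.
have := ps e (mem_head _ _).
by case/orP: exy => /eqP-> /color_edge.
Qed.

(** An edge of a cycle could be removed without disconnecting its ends, and the remaining edges
    would be too few to connect all vertices. *)
Lemma connected_card_tree (G : multigraph) :
  connected G -> #|mvertex G| = #|medge G|.+1 -> is_tree G.
Proof.
move=> Gc cardG; split=> // x [|[e y] p]; first by rewrite /is_cycle.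
apply/negP => /and5P[_ /= /andP[exy yp] /eqP lastp /andP[ep _] _].
pose s := [seq mends e' | e' <- rem e (enum (medge G))].
have sE e' : e' != e -> mends e' \in s.
  by move=> ne; rewrite map_f // (rem_filter _ (enum_uniq _)) mem_filter /= ne mem_enum.
have : #|mvertex G| <= (size s).+1.
  apply: connected_color => // e'; case: (eqVneq e' e) => [->|ne].
    (* The rest of the cycle leads from [y] back to [x] and avoids [e]. *)
    have xy : color s x = color s y.
      rewrite (walk_color (s := s) yp) ?lastp // => e1 e1p; apply: sE.
      by apply: contraNneq ep => <-.
    by case/orP: exy => /eqP->.
  by apply: color_edge; rewrite -surjective_pairing sE.
rewrite size_map size_rem ?mem_enum // -cardE cardG.
have e_gt0 : 0 < #|medge G| by apply/card_gt0P; exists e.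
by rewrite (ltn_predK e_gt0) ltnn.
Qed.

Lemma path_walk (G : multigraph) (es : seq (medge G)) x p :
  path [rel u v | has (fun e => joins e u v) es] x p ->
  exists q, [/\ walk x q, unzip2 q = p & {subset unzip1 q <= es}].
Proof.
elim: p x => [|y p IHp] x /=; first by exists [::].
case/andP=> /hasP[e ees exy] /IHp[q [wq qp qes]].
exists ((e, y) :: q); split=> /=; rewrite ?exy ?qp // => e'.
by rewrite inE => /predU1P[->|/qes].
Qed.

Lemma walk_vertices (G : multigraph) x (q : seq (medge G * mvertex G)) e u v :
  walk x q -> e \in unzip1 q -> joins e u v -> u \in x :: unzip2 q.
Proof.
elim: q x => [//|[e' y] q IHq] x /= /andP[exy yq]; rewrite inE.
case/predU1P=> [->|eq] juv; last by rewrite inE (IHq y) ?orbT.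
by move: exy juv; rewrite /joins => /orP[] /eqP-> /orP[] /eqP[-> ->]; rewrite !inE eqxx ?orbT.
Qed.

(** If the first edge occurred again, its end [x] would be a later vertex of the walk. *)
Lemma simple_walk_uniq_edges (G : multigraph) x (q : seq (medge G * mvertex G)) :
  walk x q -> uniq (x :: unzip2 q) -> uniq (unzip1 q).
Proof.
elim: q x => [//|[e y] q IHq] x /= /andP[exy yq] /andP[xq uq].
rewrite (IHq y) // andbT; apply: contra xq => eq.
exact: walk_vertices yq eq exy.
Qed.

(** If the ends of an edge had equal colours, a simple path through the edges after it, closed by
    that edge, would be a cycle. *)
Lemma acyclic_forest (G : multigraph) (es : seq (medge G)) :
  acyclic G -> uniq es -> forest (map (@mends G) es).
Proof.
move=> Gac; elim: es => [//|e es IHes] /= /andP[ees ues].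
case ee: (mends e) => [x y] /=; rewrite IHes // andbT.
apply/negP=> /eqP xy.
have /connectP[p0 /shortenP[p xp up _] yp] :
    connect [rel u v | has (fun e => joins e u v) es] x y.
  apply: color_connect xy => [u v|_ /mapP[e' e'es ->]] /=.
    by apply: eq_has => e'; rewrite joins_sym.
  by apply/hasP; exists e' => //; rewrite /joins -surjective_pairing eqxx.
have [q [wq qp qes]] := path_walk xp.
have := Gac x (rcons q (e, x)); rewrite /is_cycle /unzip1 /unzip2 !map_rcons.
rewrite last_rcons eqxx !rcons_uniq /= -/(unzip1 q) -/(unzip2 q) qp.
rewrite andbC -andbA; move: (up) => /= /andP[-> ->] /=.
rewrite (@simple_walk_uniq_edges _ x) ?qp //.
have -> /= : e \notin unzip1 q by apply: contra ees => /qes.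
have wx : forall z, walk z q -> last z (unzip2 q) = y -> walk z (rcons q (e, x)).
  elim: q {wq qp qes} => [|[e' z'] q IHq] z /= ; last by case/andP=> -> /IHq.
  by move=> _ ->; rewrite /joins ee eqxx orbT.
by rewrite wx ?qp //; case: (q).
Qed.

(** The edges form a forest, so the vertices exceed them by the number of colours, which is positive
    because of [x]. *)
Lemma tree_card (G : multigraph) (x : mvertex G) :
  is_tree G -> #|mvertex G| = #|medge G|.+1.
Proof.
case=> Gac Gc; apply/eqP; rewrite eqn_leq connected_card //=.
rewrite (card_color_forest (acyclic_forest Gac (enum_uniq (medge G)))).
rewrite size_map -cardE -add1n leq_add2r card_gt0.
by apply/set0Pn; exists (color [seq mends i | i <- enum (medge G)] x); apply: imset_f.
Qed.

(** The map [h] is onto because [g] is a section of it; an edge of [G] may become a path of [H],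
    possibly a trivial one. *)
Lemma connected_map (G H : multigraph) (h : mvertex G -> mvertex H)
    (g : mvertex H -> mvertex G) :
  cancel g h ->
  (forall e : medge G, connect (@adjacent H) (h (mends e).1) (h (mends e).2)) ->
  connected G -> connected H.
Proof.
move=> gK hE Gc x y; rewrite -(gK x) -(gK y).
apply: (connect_invariant (S := fun v => connect (@adjacent H) (h (g x)) (h v))
  _ (Gc (g x) (g y)) (connect0 _ _)) => u v /existsP[e euv] /connect_trans; apply.
by have := hE e; case/orP: euv => /eqP-> //=; rewrite connectC.
Qed.

(* Only the ends of [e1] and [e2] are changed, so that all graphs compared in
   [connected_exchange] have the same vertices and the same number of edges. *)
Definition redirect (V E : finType) (ends : E -> V * V) (e1 e2 : E) (p1 p2 : V * V) :
  multigraph :=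
  @MultiGraph V E
    (fun e => if e == e1 then p1 else if e == e2 then p2 else ends e).

(** Here [e1] and [e2] are the new cuts [bb'] and [cc']; the redirected graphs are [H + bc + bb']
    and [H + bc + bc']. *)
Lemma connected_exchange (V E : finType) (ends : E -> V * V) (e1 e2 : E)
    (b c b' c' : V) :
  let G := @MultiGraph V E ends in
  e1 != e2 -> #|V| = #|E|.+1 ->
  @joins G e1 b b' -> @joins G e2 c c' ->
  connected (redirect ends e1 e2 (b, c) (b, b')) ->
  connected (redirect ends e1 e2 (b, c) (b, c')) ->
  connected G.
Proof.
move=> G e12 cardV j1 j2 L R.
(* Loops at [b] stand for deleting [e1] and [e2]; in [K] both edges join [b] and [c]. *)
pose H := redirect ends e1 e2 (b, b) (b, b).
pose K := redirect ends e1 e2 (b, c) (b, c).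
have HsubP (F : multigraph) (h : mvertex H -> mvertex F) :
  (forall e, e != e1 -> e != e2 -> connect (@adjacent F) (h (ends e).1) (h (ends e).2)) ->
  forall x y, connect (@adjacent H) x y -> connect (@adjacent F) (h x) (h y).
  move=> hE x y xy.
  apply: (connect_invariant (S := fun v => connect (@adjacent F) (h x) (h v))
    _ xy (connect0 _ _)) => u v /existsP[e euv] /connect_trans; apply.
  case: (eqVneq e e1) euv => [->|n1].
    by rewrite /joins /= eqxx => /orP[] /eqP[-> ->].
  case: (eqVneq e e2) => [->|n2].
    by rewrite /joins /= (eq_sym e2 e1) (negPf e12) eqxx => /orP[] /eqP[-> ->].
  rewrite /joins /= (negPf n1) (negPf n2); have := hE e n1 n2.
  by move=> + /orP[] /eqP ee; rewrite ee //= connectC.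
have others p1 p2 e : e != e1 -> e != e2 ->
    connect (@adjacent (redirect ends e1 e2 p1 p2)) (ends e).1 (ends e).2.
  move=> n1 n2; have := @mends_connect (redirect ends e1 e2 p1 p2) e.
  by rewrite /= (negPf n1) (negPf n2).
have othersG e : connect (@adjacent G) (ends e).1 (ends e).2.
  exact: (@mends_connect G e).
have HK x y : connect (@adjacent H) x y -> connect (@adjacent K) x y.
  by apply: (HsubP K id); apply: others.
have HG x y : connect (@adjacent H) x y -> connect (@adjacent G) x y.
  by apply: (HsubP G id) => e _ _.
have bcK : connect (@adjacent K) b c.
  by have := @mends_connect K e1; rewrite /= eqxx.
(* By counting, a connected [K] would be a tree, but it contains a loop if [b = c] and two parallel
   edges otherwise. *)
have notK : ~ connected K.
  move=> Kc; have [/(_ b) Kac _] := connected_card_tree Kc cardV.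
  case: (eqVneq b c) => [bc|nbc].
    by have := Kac [:: (e1, b)]; rewrite /is_cycle /= /joins /= bc !eqxx.
  have := Kac [:: (e1, c); (e2, b)].
  rewrite /is_cycle /= /joins /= (eq_sym e2 e1) (negPf e12) !eqxx /= orbT.
  by rewrite !inE e12 eq_sym nbc.
(* Otherwise [K] would connect the ends of every edge of the first redirected graph, and so be
   connected. *)
have notb : ~ connect (@adjacent K) b b'.
  move=> bb'; apply: notK.
  apply: (@connected_map (redirect ends e1 e2 (b, c) (b, b')) K id id _ _ L) => // e /=.
  case: (eqVneq e e1) => [//|n1]; case: (eqVneq e e2) => [//|n2].
  exact: others.
(* In the second redirected graph, edges outside [H] join only [b], [c] and [c'], so the
   [H]-components of these three cover all vertices. *)
have b'H : [\/ connect (@adjacent H) b b', connect (@adjacent H) c b'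
             | connect (@adjacent H) c' b'].
  pose S w := [\/ connect (@adjacent H) b w, connect (@adjacent H) c w
             | connect (@adjacent H) c' w].
  have S_b : S b by constructor 1; apply: connect0.
  have S_c : S c by constructor 2; apply: connect0.
  have S_c' : S c' by constructor 3; apply: connect0.
  apply: (connect_invariant (S := S) _ (R b b')) => // u v.
  case/existsP=> e; rewrite /joins /=.
  case: (eqVneq e e1) => [_|n1]; first by case/orP=> /eqP[<- <-].
  case: (eqVneq e e2) => [_|n2]; first by case/orP=> /eqP[<- <-].
  move=> euv; have uv : connect (@adjacent H) u v.
    by case/orP: euv => /eqP ee; [|rewrite connectC];
      have := others (b, b) (b, b) e n1 n2; rewrite ee.
  by case=> xu; [constructor 1|constructor 2|constructor 3];
    apply: connect_trans xu uv.
have b'c' : connect (@adjacent G) b' c'.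
  case: b'H => [bb'|cb'|]; last by rewrite (@connectC G); apply: HG.
    by case: notb; apply: HK.
  by case: notb; apply: connect_trans bcK (HK _ _ cb').
have bb' := joins_connect j1; have cc' := joins_connect j2.
(* The edge [bc] is replaced by a path through [b], [b'], [c'], [c]. *)
apply: (@connected_map (redirect ends e1 e2 (b, c) (b, b')) G id id _ _ L) => // e /=.
case: (eqVneq e e1) => [_|n1] /=.
  by apply: connect_trans bb' (connect_trans b'c' _); rewrite connectC.
by case: (eqVneq e e2) => [_|n2].
Qed.

(** * Sizes of switching graphs *)

Lemma sum_option (T : finType) (F : option T -> nat) :
  \sum_(x : option T) F x = F None + \sum_(x : T) F (Some x).
Proof.
rewrite (bigD1 None) //=; congr (_ + _).
rewrite (reindex_omap Some id) //=; last by case.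
by apply: eq_bigl => x; rewrite eqxx.
Qed.

Fixpoint vertex_count V (A : formula V) : nat :=
  match A with
  | Atom _ => 1
  | Tensor B C | Par B C => (vertex_count B + vertex_count C).+1
  end.

(** A switching keeps both argument edges of a tensor and one of a par, so this number is the same
    for all switchings. *)
Fixpoint kept_count V (A : formula V) : nat :=
  match A with
  | Atom _ => 0
  | Tensor B C => 2 + (kept_count B + kept_count C)
  | Par B C => 1 + (kept_count B + kept_count C)
  end.

Fixpoint neg_count V (A : formula V) : nat :=
  match A with
  | Atom a => ~~ pos_atom a
  | Tensor B C | Par B C => neg_count B + neg_count C
  end.

Lemma sum_kept_arg V (A : formula V) (s : vertex A -> bool) :
  \sum_(e : arg_edge A)
    (if label (edge_parent e) is LPar then edge_side e == s (edge_parent e)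
     else true : bool) = kept_count A.
Proof.
elim: A s => [a|B IHB C IHC|B IHB C IHC] s /=.
- by apply: big1 => -[].
- rewrite big_sumType big_bool /= big_sumType /=; congr (_ + (_ + _)).
    exact: IHB (fun u => s (Some (inl u))).
  exact: IHC (fun u => s (Some (inr u))).
rewrite big_sumType big_bool /= big_sumType /=; congr (_ + (_ + _)).
- by case: (s None).
- exact: IHB (fun u => s (Some (inl u))).
exact: IHC (fun u => s (Some (inr u))).
Qed.

Lemma sum_neg_label V (A : formula V) :
  \sum_(v : vertex A) (if label v is LAtom a then ~~ pos_atom a else false : bool)
  = neg_count A.
Proof.
elim: A => [a|B IHB C IHC|B IHB C IHC] /=.
- by rewrite (big_pred1 tt) //; case.
- by rewrite sum_option /= big_sumType /= IHB IHC.
by rewrite sum_option /= big_sumType /= IHB IHC.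
Qed.

Lemma card_vertex V (A : formula V) : #|vertex A| = vertex_count A.
Proof.
elim: A => [a|B IHB C IHC|B IHB C IHC] /=; first exact: card_unit.
  by rewrite card_option card_sum IHB IHC.
by rewrite card_option card_sum IHB IHC.
Qed.

Lemma card_cs_vertex V (G : cut_sequent V) :
  #|cs_vertex G| = \sum_(t : tree G) vertex_count (tree_formula t).
Proof.
rewrite card_tagged sumnE big_map big_enum.
by apply: eq_bigr => t _; apply: card_vertex.
Qed.

Lemma card_neg_leaf V (G : cut_sequent V) :
  #|neg_leaf G| = \sum_(t : tree G) neg_count (tree_formula t).
Proof.
rewrite card_sig -sum1_card big_mkcond /=.
under [RHS]eq_bigr => t _ do rewrite -sum_neg_label.
rewrite sig_big_dep /=; refine (eq_bigr _ _) => -[t v] _ /=.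
by rewrite inE /is_neg_leaf /cs_label /=; case: (label v) => // a; case: pos_atom.
Qed.

Lemma card_kept V (G : cut_sequent V) (s : cs_vertex G -> bool) :
  #|{: {e : cs_edge G | kept s e}}| =
  \sum_(t : tree G) kept_count (tree_formula t) + #|cut G|.
Proof.
rewrite card_sig -sum1_card big_mkcond /= big_sumType /= sum1_card; congr (_ + _).
under [RHS]eq_bigr => t _ do rewrite -(sum_kept_arg (fun v => s (in_tree v))).
rewrite sig_big_dep /=; refine (eq_bigr _ _) => -[t v] _ /=.
rewrite inE /= /cs_label /=.
by case: (label _) => //; case: eqP.
Qed.

Lemma sum_tree_add_cut V (G : cut_sequent V) (A : formula V) (F : formula V -> nat) :
  \sum_(t : tree (add_cut G A)) F (tree_formula t) =
  \sum_(t : tree G) F (tree_formula t) + (F A + F (neg A)).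
Proof.
have pairs H : \sum_(p : cut H * bool) F (tree_formula (inr p : tree H)) =
    \sum_(k : cut H) (F (cut_formula k) + F (neg (cut_formula k))).
  transitivity (\sum_(k : cut H) \sum_(b : bool) F (tree_formula (inr (k, b) : tree H))).
    by rewrite pair_bigA; apply: eq_bigr => -[].
  by apply: eq_bigr => k _; rewrite big_bool addnC.
rewrite !big_sumType -addnA; congr addn.
by rewrite !pairs [RHS]addnC; apply: sum_option.
Qed.

(** For an atom, two leaves, the cut and the edge from the negative leaf disappear. For a compound
    formula, two roots and three kept argument edges disappear, and there is one cut more. *)
Lemma card_switching_graph_elim V (G : cut_sequent V) (A : formula V)
    (f : leaf_function (add_cut G A)) s
    (f' : leaf_function (elim_sequent G A)) s' :
  #|mvertex (switching_graph f s)| = #|mvertex (switching_graph f' s')| + 2 /\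
  #|medge (switching_graph f s)| = #|medge (switching_graph f' s')| + 2.
Proof.
rewrite /= !card_sum !card_kept !card_neg_leaf !card_cs_vertex.
case: A f f' s s' => [a|B C|B C] _ _ _ _; rewrite [elim_sequent _ _]/=;
  rewrite !sum_tree_add_cut /= ?card_option; split; try lia.
by case: a => /=; lia.
Qed.

(** * Vertices, leaves and edges surviving the elimination *)

(** The partial inverse of [elim_vertex], undefined exactly at the two roots of the cut pair. *)
Definition unelim_vertex V (G : cut_sequent V) (A : formula V) :
    cs_vertex (add_cut G A) -> option (cs_vertex (elim_sequent G A)) :=
  match A return cs_vertex (add_cut G A) -> option (cs_vertex (elim_sequent G A)) with
  | Atom a => fun v =>
      match v with
      | existT (inl i) u => Some (@in_tree V G (inl i) u)
      | existT (inr (Some k, false)) u => Some (@in_tree V G (inr (k, false)) u)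
      | existT (inr (Some k, true)) u => Some (@in_tree V G (inr (k, true)) u)
      | existT (inr (None, _)) _ => None
      end
  | Tensor B C => fun v =>
      let H := add_cut (add_cut G B) C in
      match v with
      | existT (inl i) u => Some (@in_tree V H (inl i) u)
      | existT (inr (Some k, false)) u =>
          Some (@in_tree V H (inr (Some (Some k), false)) u)
      | existT (inr (Some k, true)) u =>
          Some (@in_tree V H (inr (Some (Some k), true)) u)
      | existT (inr (None, false)) None => None
      | existT (inr (None, false)) (Some (inl u)) =>
          Some (@in_tree V H (inr (Some None, false)) u)
      | existT (inr (None, false)) (Some (inr u)) =>
          Some (@in_tree V H (inr (None, false)) u)
      | existT (inr (None, true)) None => None
      | existT (inr (None, true)) (Some (inl u)) =>
          Some (@in_tree V H (inr (Some None, true)) u)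
      | existT (inr (None, true)) (Some (inr u)) =>
          Some (@in_tree V H (inr (None, true)) u)
      end
  | Par B C => fun v =>
      let H := add_cut (add_cut G B) C in
      match v with
      | existT (inl i) u => Some (@in_tree V H (inl i) u)
      | existT (inr (Some k, false)) u =>
          Some (@in_tree V H (inr (Some (Some k), false)) u)
      | existT (inr (Some k, true)) u =>
          Some (@in_tree V H (inr (Some (Some k), true)) u)
      | existT (inr (None, false)) None => None
      | existT (inr (None, false)) (Some (inl u)) =>
          Some (@in_tree V H (inr (Some None, false)) u)
      | existT (inr (None, false)) (Some (inr u)) =>
          Some (@in_tree V H (inr (None, false)) u)
      | existT (inr (None, true)) None => None
      | existT (inr (None, true)) (Some (inl u)) =>
          Some (@in_tree V H (inr (Some None, true)) u)
      | existT (inr (None, true)) (Some (inr u)) =>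
          Some (@in_tree V H (inr (None, true)) u)
      end
  end.

Lemma elim_vertexK V (G : cut_sequent V) (A : formula V) :
  pcancel (@elim_vertex V G A) (@unelim_vertex V G A).
Proof.
case: A => [a|B C|B C].
- by case=> [[i|[k []]] u].
- by case=> [[i|[[[k|]|] []]] u].
- by case=> [[i|[[[k|]|] []]] u].
Qed.

Lemma elim_vertex_inj V (G : cut_sequent V) (A : formula V) :
  injective (@elim_vertex V G A).
Proof. exact: pcan_inj (@elim_vertexK V G A). Qed.

Lemma unelim_cut_root V (G : cut_sequent V) (A : formula V) b :
  unelim_vertex (cut_root G A b) = None.
Proof. by case: A b => [a|B C|B C] []. Qed.

Lemma elim_vertex_neq_root V (G : cut_sequent V) (A : formula V) v b :
  elim_vertex v <> cut_root G A b.
Proof.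
by move/(congr1 (@unelim_vertex _ _ _)); rewrite elim_vertexK unelim_cut_root.
Qed.

Lemma elim_vertex_surj V (G : cut_sequent V) (A : formula V)
    (v : cs_vertex (add_cut G A)) :
  (exists b, v = cut_root G A b) \/
  (exists u : cs_vertex (elim_sequent G A), elim_vertex u = v).
Proof.
case: A v => [a|B C|B C] v.
- case: v => [[i|[[k|] []]] u].
  + by right; exists (@in_tree V G (inl i) u).
  + by right; exists (@in_tree V G (inr (k, true)) u).
  + by right; exists (@in_tree V G (inr (k, false)) u).
  + by left; exists true; case: u.
  + by left; exists false; case: u.
all: pose H := add_cut (add_cut G B) C.
all: case: v => [[i|[[k|] []]] u];
  [ by right; exists (@in_tree V H (inl i) u)
  | by right; exists (@in_tree V H (inr (Some (Some k), true)) u)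
  | by right; exists (@in_tree V H (inr (Some (Some k), false)) u)
  | case: u => [[u|u]|]; last by left; exists true
  | case: u => [[u|u]|]; last by left; exists false ].
1,5: by right; exists (@in_tree V H (inr (Some None, true)) u).
1,4: by right; exists (@in_tree V H (inr (None, true)) u).
1,3: by right; exists (@in_tree V H (inr (Some None, false)) u).
all: by right; exists (@in_tree V H (inr (None, false)) u).
Qed.

Lemma elim_neg_leaf_surj V (G : cut_sequent V) (A : formula V)
    (l : neg_leaf (add_cut G A)) :
  (forall b, val l <> cut_root G A b) -> exists l', elim_neg_leaf l' = l.
Proof.
move=> lr; case: (elim_vertex_surj (val l)) => [[b /lr]|[u ul]] //.
have un : is_neg_leaf u by rewrite /is_neg_leaf -elim_vertex_label ul; apply: valP l.
by exists (Sub u un); apply: val_inj.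
Qed.

Lemma elim_pos_leaf_surj V (G : cut_sequent V) (A : formula V)
    (m : pos_leaf (add_cut G A)) :
  (forall b, val m <> cut_root G A b) ->
  exists m' : pos_leaf (elim_sequent G A), elim_vertex (val m') = val m.
Proof.
move=> mr; case: (elim_vertex_surj (val m)) => [[b /mr]|[u um]] //.
have up : is_pos_leaf u by rewrite /is_pos_leaf -elim_vertex_label um; apply: valP m.
by exists (Sub u up).
Qed.

Lemma elim_neg_leaf_inj V (G : cut_sequent V) (A : formula V) :
  injective (@elim_neg_leaf V G A).
Proof. by move=> l l' /(congr1 val) /elim_vertex_inj /val_inj. Qed.

(** Targets other than the two roots of the cut pair survive the elimination; uniqueness comes from
    [elim_vertex_inj]. *)
Lemma cut_elim_exists V (G : cut_sequent V) (A : formula V)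
    (f : leaf_function (add_cut G A)) :
  (forall l b, val (reset_target f (f (@elim_neg_leaf V G A l))) <> cut_root G A b) ->
  exists f' : leaf_function (elim_sequent G A), unique (cut_elim f) f'.
Proof.
move=> fr.
have /fin_all_exists[g gP] (l : neg_leaf (elim_sequent G A)) :
    exists m : pos_leaf (elim_sequent G A),
    elim_vertex (val m) = val (reset_target f (f (elim_neg_leaf l))).
  by apply: elim_pos_leaf_surj => b; apply: fr.
exists [ffun l => g l]; split=> [l|f' f'P]; first by rewrite ffunE gP.
by apply/ffunP=> l; apply/val_inj/elim_vertex_inj; rewrite ffunE gP f'P.
Qed.

Definition edge_lifts V (G : cut_sequent V) (A : formula V) (a : cs_arg_edge (add_cut G A)) :=
  exists a' : cs_arg_edge (elim_sequent G A),
  [/\ elim_vertex (in_tree (edge_parent (tagged a'))) = in_tree (edge_parent (tagged a)),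
      elim_vertex (in_tree (edge_child (tagged a'))) = in_tree (edge_child (tagged a))
    & edge_side (tagged a') = edge_side (tagged a)].

Lemma edge_lifts_atom V (G : cut_sequent V) (a : atom V)
    (e : cs_arg_edge (add_cut G (Atom a))) : edge_lifts e.
Proof.
case: e => [[i|[[k|] []]] e] //.
- by exists (Tagged (fun t : tree G => arg_edge (tree_formula t)) (i := inl i) e).
- by exists (Tagged (fun t : tree G => arg_edge (tree_formula t)) (i := inr (k, true)) e).
- by exists (Tagged (fun t : tree G => arg_edge (tree_formula t)) (i := inr (k, false)) e).
Qed.

(* For a compound [A] with arguments [B] and [C]: the root of the left ([d = false])
   or right ([d = true]) argument of [A] ([b = false]) or of [neg A] ([b = true]). *)
Definition cut_arg V (G : cut_sequent V) (B C : formula V) (b d : bool) :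
    cs_vertex (add_cut (add_cut G B) C) :=
  in_tree (Defs.root (tree_formula
    (inr (if d then None else Some None, b) : tree (add_cut (add_cut G B) C)))).

Lemma arg_edge_tensor V (G : cut_sequent V) (B C : formula V)
    (e : cs_arg_edge (add_cut G (Tensor B C))) :
  edge_lifts e \/
  (exists2 b, in_tree (edge_parent (tagged e)) = cut_root G (Tensor B C) b &
    in_tree (edge_child (tagged e)) =
    @elim_vertex V G (Tensor B C) (cut_arg G B C b (edge_side (tagged e)))).
Proof.
pose H := add_cut (add_cut G B) C.
pose lift t (x : arg_edge (tree_formula t)) : cs_arg_edge H :=
  Tagged (fun t : tree H => arg_edge (tree_formula t)) x.
case: e => [[i|[[k|] []]] e].
- by left; exists (@lift (inl i) e).
- by left; exists (@lift (inr (Some (Some k), true)) e).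
- by left; exists (@lift (inr (Some (Some k), false)) e).
- case: e => [d|[e|e]]; first by right; exists true; case: d.
    by left; exists (@lift (inr (Some None, true)) e).
  by left; exists (@lift (inr (None, true)) e).
- case: e => [d|[e|e]]; first by right; exists false; case: d.
    by left; exists (@lift (inr (Some None, false)) e).
  by left; exists (@lift (inr (None, false)) e).
Qed.

Lemma arg_edge_par V (G : cut_sequent V) (B C : formula V)
    (e : cs_arg_edge (add_cut G (Par B C))) :
  edge_lifts e \/
  (exists2 b, in_tree (edge_parent (tagged e)) = cut_root G (Par B C) b &
    in_tree (edge_child (tagged e)) =
    @elim_vertex V G (Par B C) (cut_arg G B C b (edge_side (tagged e)))).
Proof.
pose H := add_cut (add_cut G B) C.
pose lift t (x : arg_edge (tree_formula t)) : cs_arg_edge H :=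
  Tagged (fun t : tree H => arg_edge (tree_formula t)) x.
case: e => [[i|[[k|] []]] e].
- by left; exists (@lift (inl i) e).
- by left; exists (@lift (inr (Some (Some k), true)) e).
- by left; exists (@lift (inr (Some (Some k), false)) e).
- case: e => [d|[e|e]]; first by right; exists true; case: d.
    by left; exists (@lift (inr (Some None, true)) e).
  by left; exists (@lift (inr (None, true)) e).
- case: e => [d|[e|e]]; first by right; exists false; case: d.
    by left; exists (@lift (inr (Some None, false)) e).
  by left; exists (@lift (inr (None, false)) e).
Qed.

(** * Connectedness of the new switching graphs *)

(** The quotient map that contracts both roots of the cut pair to [q]. *)
Definition contract V (G : cut_sequent V) (A : formula V)
    (q : cs_vertex (elim_sequent G A)) (v : cs_vertex (add_cut G A)) :
    cs_vertex (elim_sequent G A) :=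
  odflt q (unelim_vertex v).

Lemma elim_vertex_contractK V (G : cut_sequent V) (A : formula V) q :
  cancel (@elim_vertex V G A) (contract q).
Proof. by move=> v; rewrite /contract elim_vertexK. Qed.

Lemma contract_root V (G : cut_sequent V) (A : formula V) q b :
  contract q (cut_root G A b) = q.
Proof. by rewrite /contract unelim_cut_root. Qed.

(** The last clause makes [e] an argument edge, hence distinct from the two new cuts that
    [compound_connected] redirects. *)
Lemma edge_lift_connect V (G : cut_sequent V) (A : formula V)
    (f' : leaf_function (elim_sequent G A)) s s' q (a : cs_arg_edge (add_cut G A)) :
  edge_lifts a -> kept s (inl a) ->
  (forall v, s (elim_vertex v) = s' v) ->
  exists2 e : medge (switching_graph f' s'),
    mends e = (contract q (in_tree (edge_parent (tagged a))),
               contract q (in_tree (edge_child (tagged a)))) &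
    exists a' k, e = inl (Sub (inl a') k).
Proof.
case=> a' [pE cE dE] ka ss'.
have ka' : kept s' (inl a').
  by move: ka; rewrite /= -pE -dE elim_vertex_label ss'.
exists (inl (Sub (inl a') ka')); last by exists a', ka'.
by rewrite /= -pE -cE !elim_vertex_contractK.
Qed.

Lemma joins_mends (G : multigraph) (e : medge G) x y :
  mends e = (x, y) -> connect (@adjacent G) x y.
Proof. by move=> eE; apply: (joins_connect (e := e)); rewrite /joins eE eqxx. Qed.

Lemma cut_root_is_neg V (G : cut_sequent V) (a : atom V) b :
  is_neg_leaf (cut_root G (Atom a) b) = (b == pos_atom a).
Proof. by case: a b => [P|P||] []. Qed.

Lemma cut_root_pos V (G : cut_sequent V) (a : atom V) b :
  is_pos_leaf (cut_root G (Atom a) b) = (b == ~~ pos_atom a).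
Proof. by case: a b => [P|P||] []. Qed.

(** Otherwise the cut and the edge of [f] from the negative leaf would be parallel, a cycle of
    length two. *)
Lemma cut_leaf_not_target V (G : cut_sequent V) (a : atom V)
    (f : leaf_function (add_cut G (Atom a))) s :
  acyclic (switching_graph f s) ->
  val (f (cut_neg_leaf G a)) <> cut_root G (Atom a) (~~ pos_atom a).
Proof.
move=> fac fp.
have := fac (cut_root G (Atom a) (~~ pos_atom a))
  [:: (inl (Sub (inr None) isT), cut_root G (Atom a) (pos_atom a));
      (inr (cut_neg_leaf G a), cut_root G (Atom a) (~~ pos_atom a))].
rewrite /is_cycle /= /joins /= fp !eqxx !inE /=.
by case: (pos_atom a); rewrite !eqxx ?orbT.
Qed.

(** Once both cut leaves are contracted to the target of the negative one, the cut and the edge from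
    that leaf are loops, and every edge into the positive leaf has the target given by [f']. *)
Lemma atom_connected V (G : cut_sequent V) (a : atom V)
    (f : leaf_function (add_cut G (Atom a)))
    (f' : leaf_function (elim_sequent G (Atom a))) :
  cut_elim f f' ->
  (forall s, is_tree (switching_graph f s)) ->
  forall s', connected (switching_graph f' s').
Proof.
move=> ff' ftree s'.
have fnp := cut_leaf_not_target (ftree xpredT).1.
case: (elim_vertex_surj (val (f (cut_neg_leaf G a)))) => [[b fn]|[q fn]].
  have := valP (f (cut_neg_leaf G a)); rewrite fn cut_root_pos => /eqP bE.
  by case: fnp; rewrite fn bE.
pose s v := s' (contract q v).
apply: (@connected_map (switching_graph f s) (switching_graph f' s') (contract q) _
  (elim_vertex_contractK q) _ (ftree s).2).
case=> [[[e|[k|]] ke]|l].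
- have [|e' + _] := edge_lift_connect f' (s' := s') q (edge_lifts_atom e) ke.
    by move=> v; rewrite /s elim_vertex_contractK.
  exact: joins_mends.
- exact: (@mends_connect (switching_graph f' s') (inl (Sub (inr k) isT))).
- rewrite -/(cut_root G (Atom a) false) -/(cut_root G (Atom a) true).
  by rewrite !contract_root.
- case: (eqVneq l (cut_neg_leaf G a)) => [->|ln].
    by rewrite /= -fn elim_vertex_contractK contract_root.
  have [l' l'E] : exists l' : neg_leaf (elim_sequent G (Atom a)), elim_neg_leaf l' = l.
    apply: elim_neg_leaf_surj => b lb; case/eqP: ln; apply: val_inj => /=; rewrite lb.
    by have := valP l; rewrite lb cut_root_is_neg => /eqP->.
  have f'l' : contract q (val (f l)) = val (f' l').
    apply: elim_vertex_inj; rewrite ff' l'E [reset_target _ _]/=.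
    have := ff' l'; rewrite l'E [reset_target _ _]/=.
    case: eqP => [lp _|_ <-]; last by rewrite elim_vertex_contractK.
    by rewrite -[val (f l)]/(sval (f l)) lp contract_root fn.
  rewrite -[mends _]/(val l, val (f l)) f'l' -{1}l'E elim_vertex_contractK.
  exact: (@mends_connect (switching_graph f' s') (inr l')).
Qed.

(* What a tensor and a par have in common: [p] is the side of the cut pair whose
   root is a par, [k1] and [k2] are the new cuts, and [x b d] is the root of the
   left ([d = false]) or right ([d = true]) argument of the root on side [b]. *)
Record compound_cut V (G : cut_sequent V) (A : formula V)
    (k1 k2 : cut (elim_sequent G A)) (p : bool)
    (x : bool -> bool -> cs_vertex (elim_sequent G A)) : Prop := CompoundCut {
  compound_root : forall b,
    cs_label (cut_root G A b) = if b == p then LPar else LTensor;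
  compound_neq : k1 != k2;
  compound_ends1 :
    @cs_ends V (elim_sequent G A) (inr k1) = (x false false, x true false);
  compound_ends2 :
    @cs_ends V (elim_sequent G A) (inr k2) = (x false true, x true true);
  compound_old : forall k : cut G, exists k' : cut (elim_sequent G A),
    [/\ k' != k1, k' != k2,
       elim_vertex (@cs_ends V (elim_sequent G A) (inr k')).1 =
         (@cs_ends V (add_cut G A) (inr (Some k))).1 &
       elim_vertex (@cs_ends V (elim_sequent G A) (inr k')).2 =
         (@cs_ends V (add_cut G A) (inr (Some k))).2];
  compound_arg : forall e : cs_arg_edge (add_cut G A), edge_lifts e \/
    exists2 b, in_tree (edge_parent (tagged e)) = cut_root G A b &
      in_tree (edge_child (tagged e)) = elim_vertex (x b (edge_side (tagged e)))
}.

(** Contracting both roots to the left argument [q] of the tensor turns an old switching graph into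
    one of the two graphs of [connected_exchange]; the choice at the par root decides which. *)
Lemma compound_connected V (G : cut_sequent V) (A : formula V)
    (f : leaf_function (add_cut G A)) (f' : leaf_function (elim_sequent G A))
    (k1 k2 : cut (elim_sequent G A)) (p : bool)
    (x : bool -> bool -> cs_vertex (elim_sequent G A)) :
  compound_cut k1 k2 p x ->
  (forall l, elim_vertex (val (f' l)) = val (f (elim_neg_leaf l))) ->
  (forall s, is_tree (switching_graph f s)) ->
  forall s', connected (switching_graph f' s').
Proof.
move=> [rootL k12 k1E k2E oldk argE] ff' ftree s'.
pose G' := switching_graph f' s'.
pose e1 : medge G' := inl (Sub (inr k1) isT).
pose e2 : medge G' := inl (Sub (inr k2) isT).
pose q := x (~~ p) false.
have e12 : e1 != e2 by [].
have half d : connected (redirect (@mends G') e1 e2 (q, x (~~ p) true) (q, x p d)).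
  set H := redirect _ _ _ _ _.
  (* The old switching keeps side [d] at the par root and agrees with [s'] at the surviving
     vertices. *)
  pose s v := if v == cut_root G A p then d else s' (contract q v).
  have sE v : s (elim_vertex v) = s' v.
    by rewrite /s elim_vertex_contractK; case: eqP => [/elim_vertex_neq_root|].
  have H1 : connect (@adjacent H) q (x (~~ p) true).
    by apply: (joins_mends (e := e1 : medge H)); rewrite /= eqxx.
  have H2 : connect (@adjacent H) q (x p d).
    by apply: (joins_mends (e := e2 : medge H)); rewrite /= eq_sym (negPf e12) eqxx.
  have H3 (e : medge G') : e != e1 -> e != e2 ->
      connect (@adjacent H) (mends e).1 (mends e).2.
    move=> n1 n2; have := @mends_connect H e.
    by rewrite /= (negPf n1) (negPf n2).
  apply: (@connected_map (switching_graph f s) H (contract q) _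
    (elim_vertex_contractK q) _ (ftree s).2).
  case=> [[[e|[k|]] ke]|l].
  - rewrite -[mends _]/(in_tree (edge_parent (tagged e)), in_tree (edge_child (tagged e))).
    case: (argE e) => [el|[b pE cE]].
      have [e' e'E [a' [k' e'k]]] := edge_lift_connect f' q el ke sE.
      by have := H3 e'; rewrite e'E e'k; apply.
    rewrite pE cE elim_vertex_contractK contract_root.
    (* The kept edge of the par root becomes the redirected [e2]; those of the tensor root become a
       loop at [q] and the redirected [e1]. *)
    case: (eqVneq b p) => [bp|].
      move: ke; rewrite /= pE rootL bp eqxx /s eqxx => /eqP->.
      exact: H2.
    move=> bp; have -> : b = ~~ p by case: (b) (p) bp => [] [].
    by case: (edge_side _); [apply: H1 | apply: connect0].
  - have [k' [n1 n2 c1 c2]] := oldk k.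
    rewrite -[mends _]/(@cs_ends V (add_cut G A) (inr (Some k))) -c1 -c2.
    by rewrite !elim_vertex_contractK; apply: (H3 (inl (Sub (inr k') isT))).
  - rewrite -[mends _]/(cut_root G A false, cut_root G A true).
    by rewrite !contract_root; apply: connect0.
  have [l' l'E] : exists l' : neg_leaf (elim_sequent G A), elim_neg_leaf l' = l.
    apply: elim_neg_leaf_surj => b lb; have := valP l.
    by rewrite lb /is_neg_leaf rootL; case: (b == p).
  rewrite -[mends _]/(val l, val (f l)) -l'E -ff' !elim_vertex_contractK.
  exact: (H3 (inr l')).
have cardG' : #|mvertex G'| = #|medge G'|.+1.
  have [cv ce] := card_switching_graph_elim f xpredT f' s'.
  have := tree_card (cut_root G A p : mvertex (switching_graph f xpredT)) (ftree xpredT).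
  by rewrite cv ce -addSn => /addIn.
apply: (connected_exchange (e1 := e1) (e2 := e2) e12 cardG' _ _ (half false) (half true)).
  by rewrite /joins [mends _]k1E /q; case: (p); rewrite !eqxx ?orbT.
by rewrite /joins [mends _]k2E /q; case: (p); rewrite !eqxx ?orbT.
Qed.

(** * Proof nets *)

(** Vertices and edges both decrease by two, so there is still one vertex more than edges. *)
Lemma elim_tree V (G : cut_sequent V) (A : formula V)
    (f : leaf_function (add_cut G A)) (f' : leaf_function (elim_sequent G A)) s s' :
  is_tree (switching_graph f s) -> connected (switching_graph f' s') ->
  is_tree (switching_graph f' s').
Proof.
move=> ft f'c; apply: connected_card_tree => //.
have [cv ce] := card_switching_graph_elim f s f' s'.
have := tree_card (cut_root G A true : mvertex (switching_graph f s)) ft.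
by rewrite cv ce -addSn => /addIn.
Qed.

Lemma elim_dual_leaves (V : eqType) (G : cut_sequent V) (A : formula V) P
    (l : neg_leaf (elim_sequent G A)) :
  (elim_neg_leaf l \in dual_leaves (add_cut G A) P) =
  (l \in dual_leaves (elim_sequent G A) P).
Proof. by rewrite !inE elim_vertex_label. Qed.

Lemma matching_compound (V : eqType) (G : cut_sequent V) (A : formula V)
    (f : leaf_function (add_cut G A)) (f' : leaf_function (elim_sequent G A)) :
  (forall b, if cs_label (cut_root G A b) is LAtom _ then false else true) ->
  (forall l, elim_vertex (val (f' l)) = val (f (elim_neg_leaf l))) ->
  matching f -> matching f'.
Proof.
move=> rootL ff' fm P; have [fI fE] := fm P.
split=> [l l'|].
  rewrite -!elim_dual_leaves => lP l'P ll'; apply: elim_neg_leaf_inj.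
  by apply: fI => //; apply: val_inj; rewrite -!ff' ll'.
apply/setP=> m; apply/imsetP/idP => [[l lP ->]|mP].
  have : f (elim_neg_leaf l) \in var_leaves (add_cut G A) P.
    by rewrite -fE imset_f // elim_dual_leaves.
  by rewrite !inE -ff' elim_vertex_label.
have mp : is_pos_leaf (elim_vertex (val m)).
  by rewrite /is_pos_leaf elim_vertex_label; apply: (valP m).
have : Sub (elim_vertex (val m)) mp \in var_leaves (add_cut G A) P.
  by rewrite inE /= elim_vertex_label; rewrite inE in mP.
rewrite -fE => /imsetP[k kP mk].
have [l lk] : exists l, elim_neg_leaf l = k.
  apply: elim_neg_leaf_surj => b kb; have := valP k; have := rootL b.
  by rewrite kb /is_neg_leaf; case: cs_label.
exists l; first by rewrite -elim_dual_leaves lk.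
by apply/val_inj/elim_vertex_inj; rewrite ff' lk -mk.
Qed.

Lemma cut_leaves_matched (V : eqType) (G : cut_sequent V) (a : atom V) P
    (m : pos_leaf (add_cut G (Atom a))) :
  val m = cut_root G (Atom a) (~~ pos_atom a) ->
  (cut_neg_leaf G a \in dual_leaves (add_cut G (Atom a)) P) =
  (m \in var_leaves (add_cut G (Atom a)) P).
Proof. by rewrite !inE => ->; case: a m => [Q|Q||]. Qed.

(** The bijection on the leaves of [P] is shortened at the cut: the leaf that was matched with [p]
    is now matched with the target of [n]. *)
Lemma matching_atom (V : eqType) (G : cut_sequent V) (a : atom V)
    (f : leaf_function (add_cut G (Atom a)))
    (f' : leaf_function (elim_sequent G (Atom a))) :
  val (f (cut_neg_leaf G a)) <> cut_root G (Atom a) (~~ pos_atom a) ->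
  cut_elim f f' -> matching f -> matching f'.
Proof.
set n := cut_neg_leaf G a; set p := cut_root G _ _ => fnp ff' fm P.
have [fI fE] := fm P.
(* If [p] is matched among the leaves of [P], so is [n], since the two bear dual atoms. *)
have nP k : k \in dual_leaves _ P -> val (f k) = p -> n \in dual_leaves _ P.
  by move=> kP /(cut_leaves_matched P) ->; rewrite -fE imset_f.
have nl (l : neg_leaf (elim_sequent G (Atom a))) : elim_neg_leaf l <> n.
  by move/(congr1 val)/elim_vertex_neq_root.
have f'E l : elim_vertex (val (f' l)) =
    val (if val (f (elim_neg_leaf l)) == p then f n else f (elim_neg_leaf l)).
  exact: ff'.
have f'var l : l \in dual_leaves (elim_sequent G (Atom a)) P ->
    f' l \in var_leaves (elim_sequent G (Atom a)) P.
  rewrite -elim_dual_leaves => lP.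
  have : (if val (f (elim_neg_leaf l)) == p then f n else f (elim_neg_leaf l))
      \in var_leaves (add_cut G (Atom a)) P.
    by rewrite -fE; case: eqP => [/(nP _ lP) nP'|_]; apply: imset_f.
  by rewrite !inE -f'E elim_vertex_label.
split=> [l l'|].
  rewrite -!elim_dual_leaves => lP l'P ll'; apply: elim_neg_leaf_inj.
  have := f'E l; rewrite ll' f'E => /val_inj.
  (* In the two mixed cases a surviving leaf would share its target with [n], and so equal [n]. *)
  case: eqP => [l'p|_]; case: eqP => [lp|_].
  - by move=> _; apply: fI => //; apply: val_inj; rewrite lp.
  - by move/(fI _ _ (nP _ l'P l'p) lP)/esym/nl.
  - by move/esym/(fI _ _ (nP _ lP lp) l'P)/esym/nl.
  - by move/esym/fI; apply.
apply/setP=> m; apply/imsetP/idP => [[l lP ->]|mP]; first exact: f'var.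
have mp : is_pos_leaf (elim_vertex (val m)).
  by rewrite /is_pos_leaf elim_vertex_label; apply: (valP m).
have : Sub (elim_vertex (val m)) mp \in var_leaves (add_cut G (Atom a)) P.
  by rewrite inE /= elim_vertex_label; rewrite inE in mP.
have lift k : k <> n -> exists l, @elim_neg_leaf V G (Atom a) l = k.
  move=> kn; apply: elim_neg_leaf_surj => b kb; apply/kn/val_inj; rewrite kb /=.
  by have := valP k; rewrite kb cut_root_is_neg => /eqP->.
rewrite -fE => /imsetP[k kP /(congr1 val) mk].
have {}mk : elim_vertex (val m) = val (f k) := mk.
case: (eqVneq k n) => [kn|/eqP /lift[l lk]]; last first.
  exists l; first by rewrite -(@elim_dual_leaves V G (Atom a)) lk.
  apply/val_inj/(@elim_vertex_inj V G (Atom a)); rewrite f'E lk ifF //.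
  by apply/eqP; rewrite -mk => /elim_vertex_neq_root.
(* The old source of [m] is [n], so the new one is the leaf [j] that [f] sends to [p]; it differs
   from [n] by [fnp]. *)
have pp : is_pos_leaf p by rewrite cut_root_pos.
have : Sub p pp \in var_leaves (add_cut G (Atom a)) P.
  by rewrite -(@cut_leaves_matched _ _ _ P) // -/n -kn.
rewrite -fE => /imsetP[j jP /(congr1 val) pj].
have {}pj : p = val (f j) := pj.
have [l lj] : exists l, @elim_neg_leaf V G (Atom a) l = j.
  by apply: lift => jn; apply: fnp; rewrite -jn -pj.
exists l; first by rewrite -(@elim_dual_leaves V G (Atom a)) lj.
by apply/val_inj/(@elim_vertex_inj V G (Atom a)); rewrite f'E lj -pj eqxx -kn.
Qed.

Lemma compound_proof_net (V : eqType) (G : cut_sequent V) (A : formula V)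
    (f : leaf_function (add_cut G A))
    (k1 k2 : cut (elim_sequent G A)) (p : bool)
    (x : bool -> bool -> cs_vertex (elim_sequent G A)) :
  (forall m, reset_target f m = m) ->
  compound_cut k1 k2 p x ->
  proof_net f ->
  exists2 f' : leaf_function (elim_sequent G A),
    unique (cut_elim f) f' & proof_net f'.
Proof.
move=> rE xP [fm ft]; have rootL := compound_root xP.
have [|f' f'U] := @cut_elim_exists V G A f.
  move=> l b; rewrite rE => lb; have := valP (f (elim_neg_leaf l)).
  by rewrite lb /is_pos_leaf rootL; case: (b == p).
have ff' l : elim_vertex (val (f' l)) = val (f (elim_neg_leaf l)).
  by rewrite f'U.1 rE.
exists f' => //; split.
  by apply: matching_compound ff' fm => b; rewrite rootL; case: (b == p).
move=> s'; apply: elim_tree (ft xpredT) _.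
exact: compound_connected xP ff' ft s'.
Qed.

Lemma atom_proof_net (V : eqType) (G : cut_sequent V) (a : atom V)
    (f : leaf_function (add_cut G (Atom a))) :
  proof_net f ->
  exists2 f' : leaf_function (elim_sequent G (Atom a)),
    unique (cut_elim f) f' & proof_net f'.
Proof.
case=> fm ft; have fnp := cut_leaf_not_target (ft xpredT).1.
have [|f' f'U] := @cut_elim_exists V G (Atom a) f.
  (* The reset target is positive and, by [fnp], is not the positive cut leaf; the other cut leaf is
     negative. *)
  move=> l b /=; set m := if _ then _ else _.
  have mp : val m <> cut_root G (Atom a) (~~ pos_atom a) by rewrite /m; case: eqP.
  move=> mb; have {}mb : val m = cut_root G (Atom a) b := mb.
  by have := valP m; rewrite mb cut_root_pos => /eqP bE; apply: mp; rewrite mb bE.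
exists f' => //; split; first exact: matching_atom fnp f'U.1 fm.
by move=> s'; apply: elim_tree (ft xpredT) _; apply: atom_connected f'U.1 ft s'.
Qed.

Theorem theorem2 (V : eqType) (G : cut_sequent V) (A : formula V)
    (f : leaf_function (add_cut G A)) :
  proof_net f ->
  exists2 f' : leaf_function (elim_sequent G A),
    unique (cut_elim f) f' & proof_net f'.
Proof.
case: A f => [a|B C|B C] f; first exact: atom_proof_net.
  (* [Some None] and [None] are the new cuts on [B] and [C]. The par root belongs to the negated
     formula, on side [true]; when [A] is itself a par, it is on side [false]. *)
  apply: (@compound_proof_net V G (Tensor B C) f (Some None) None true (cut_arg G B C)) => //.
  split=> //; [by case | by move=> k; exists (Some (Some k)) | exact: arg_edge_tensor].
apply: (@compound_proof_net V G (Par B C) f (Some None) None false (cut_arg G B C)) => //.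
by split=> //; [case | move=> k; exists (Some (Some k)) | exact: arg_edge_par].
Qed.
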